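(* Let $G$ be a finite group, let $V$ be a rational FPF representation of $G$ of dimension $n=\dim_{\mathbb{Q}}V$, let $L\subset V$ be a $G$-invariant full-rank lattice, and consider the induced $G$-action on $V_{\mathbb{C}}/L$. Let $F=\{x\in V_{\mathbb{C}}/L : G_x\neq\{e\}\}$ and let $\pi\colon V_{\mathbb{C}}/L\to (V_{\mathbb{C}}/L)/G= V_{\mathbb{C}}/(G\ltimes L)$ be the quotient map. Then the number of singular points of the quotient $V_{\mathbb{C}}/(G\ltimes L)$ is \[|\pi(F)|=\frac{1}{|G|}\sum_{d\mid |G|} (\varphi(d)-\mu(d))\cdot c_d(G)\cdot\Phi_{d}(1)^{\frac{n}{\varphi(d)}},\] where $c_d(G)$ is the number of cyclic subgroups of $G$ of order $d$.
   Context: A rational FPF (fixed-point-free) representation of a finite group $G$ is a nonzero finite-dimensional $\mathbb{Q}$-vector space $V$ with a linear $G$-action such that $\det(g-\mathrm{id}\mid V)\neq 0$ for every non-identity $g\in G$. A $G$-invariant full-rank lattice $L\subset V$ is a $G$-stable free $\mathbb{Z}$-submodule spanned by a $\mathbb{Q}$-basis of $V$. Put $V_{\mathbb{C}}=V\otimes_{\mathbb{Q}}\mathbb{C}$; the action of $G$ extends $\mathbb{C}$-linearly to $V_{\mathbb{C}}$ and induces an action on the torus $V_{\mathbb{C}}/L\cong(\mathbb{C}/\mathbb{Z})^n$ by $g\cdot[x]=[gx]$. $G_x$ denotes the stabilizer of $x$. The singular points of the quotient orbifold are by convention the points of $\pi(F)$, i.e. the images of points with nontrivial stabilizer. Here $\mu$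 is the classical Möbius function, $\varphi$ is Euler's totient function, and $\Phi_d$ is the $d$-th cyclotomic polynomial (so $\Phi_1(1)=0$). *)

(* Defs.v *)
From HB Require Import structures.
From mathcomp Require Import all_boot all_order all_algebra all_fingroup.
From mathcomp Require Import cyclic cyclotomic mxrepresentation finmap complex.
From mathcomp Require Import boolp classical_sets cardinality reals exp.

Set Implicit Arguments.
Unset Strict Implicit.
Unset Printing Implicit Defensive.

Import Order.TTheory GRing.Theory Num.Theory.
Local Open Scope classical_set_scope.
Local Open Scope ring_scope.
Local Open Scope quotient_scope.

(* Representations act on column vectors, v |-> rG g *m v, which is a left
   action since rG (g * h) = rG g *m rG h; in coordinates V is 'cV[rat]_n. *)

Definition fpf_repr (gT : finGroupType) (G : {group gT}) (n : nat)
    (rG : mx_representation rat G n) : Prop :=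
  (0 < n)%N /\
  forall g : gT, g \in G -> g != 1%g -> \det (rG g - 1%:M) != 0.

Definition full_rank_lattice (n : nat) (L : zmodClosed 'cV[rat]_n) : Prop :=
  exists2 b : (\dim {:'cV[rat]_n}).-tuple 'cV[rat]_n,
    basis_of {:'cV[rat]_n} b & forall v, v \in L <-> inIntSpan b v.

Definition repr_stable (gT : finGroupType) (G : {group gT}) (n : nat)
    (rG : mx_representation rat G n) (L : zmodClosed 'cV[rat]_n) : Prop :=
  forall (g : gT) (v : 'cV[rat]_n), g \in G -> v \in L -> rG g *m v \in L.

(* The image of L under v |-> v (x) 1, from V to V_C = C^n. *)
Definition complex_lattice (R : realType) (n : nat) (L : zmodClosed 'cV[rat]_n)
    : 'cV[R[i]]_n -> bool :=
  fun x => `[< exists2 v : 'cV[rat]_n, v \in L & x = map_mx ratr v >].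

Arguments complex_lattice R {n} L.

Lemma complex_lattice_zmod_closed (R : realType) (n : nat)
  (L : zmodClosed 'cV[rat]_n) : zmod_closed (complex_lattice R L).
Proof.
split; first by apply/asboolP; exists 0; rewrite ?rpred0 // map_mx0.
move=> _ _ /asboolP[v vL ->] /asboolP[w wL ->]; apply/asboolP.
by exists (v - w); rewrite ?rpredB // map_mxB.
Qed.

HB.instance Definition _ (R : realType) (n : nat) (L : zmodClosed 'cV[rat]_n) :=
  GRing.isZmodClosed.Build 'cV[R[i]]_n (complex_lattice R L)
    (complex_lattice_zmod_closed R L).

Definition complex_lattice_zmod (R : realType) (n : nat)
    (L : zmodClosed 'cV[rat]_n) : zmodClosed 'cV[R[i]]_n :=
  GRing.ZmodClosed.clone _ (complex_lattice R L) _.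

Arguments complex_lattice_zmod R {n} L.

Definition torus (R : realType) (n : nat) (L : zmodClosed 'cV[rat]_n) : Type :=
  Quotient.quot (complex_lattice_zmod R L).

Arguments torus R {n} L.

HB.instance Definition _ (R : realType) (n : nat) (L : zmodClosed 'cV[rat]_n) :=
  GRing.Zmodule.copy (torus R L)
    (Quotient.quot (complex_lattice_zmod R L)).

Definition torus_proj (R : realType) (n : nat) (L : zmodClosed 'cV[rat]_n)
    (x : 'cV[R[i]]_n) : torus R L :=
  \pi_(Quotient.quot (complex_lattice_zmod R L)) x.

(* g . [x] = [g x]; see torus_act_proj for independence of the choice of x. *)
Definition torus_act (R : realType) (gT : finGroupType) (G : {group gT})
    (n : nat) (rG : mx_representation rat G n) (L : zmodClosed 'cV[rat]_n)
    (g : gT) (p : torus R L) : torus R L :=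
  torus_proj L (map_mx ratr (rG g) *m generic_quotient.repr p).

Lemma torus_projP (R : realType) (n : nat) (L : zmodClosed 'cV[rat]_n)
    (x y : 'cV[R[i]]_n) :
  torus_proj L x = torus_proj L y <-> complex_lattice R L (x - y).
Proof.
have E := Quotient.idealrBE (complex_lattice_zmod R L) x y.
by split=> [/eqP|] h; [move: h; rewrite -E | apply/eqP; rewrite -E].
Qed.

Lemma torus_act_proj (R : realType) (gT : finGroupType) (G : {group gT})
    (n : nat) (rG : mx_representation rat G n) (L : zmodClosed 'cV[rat]_n)
    (g : gT) (x : 'cV[R[i]]_n) :
  repr_stable rG L -> g \in G ->
  torus_act rG g (torus_proj L x) = torus_proj L (map_mx ratr (rG g) *m x).
Proof.
move=> rGL gG; apply/torus_projP; rewrite -mulmxBr.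
have /torus_projP/asboolP[v vL ->] :
  torus_proj L (generic_quotient.repr (torus_proj L x)) = torus_proj L x by exact: reprK.
by apply/asboolP; exists (rG g *m v); [exact: rGL | rewrite map_mxM].
Qed.

Definition torus_stab (R : realType) (gT : finGroupType) (G : {group gT})
    (n : nat) (rG : mx_representation rat G n) (L : zmodClosed 'cV[rat]_n)
    (p : torus R L) : {set gT} :=
  [set g in G | torus_act rG g p == p]%SET.

Definition torus_orbit (R : realType) (gT : finGroupType) (G : {group gT})
    (n : nat) (rG : mx_representation rat G n) (L : zmodClosed 'cV[rat]_n)
    (p : torus R L) : set (torus R L) :=
  [set torus_act rG g p | g in [set g : gT | g \in G]].

Definition nontrivial_stab (R : realType) (gT : finGroupType) (G : {group gT})
    (n : nat) (rG : mx_representation rat G n) (L : zmodClosed 'cV[rat]_n)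
    : set (torus R L) :=
  [set p | torus_stab rG p <> 1%g].

Arguments nontrivial_stab R {gT G n} rG L.

(* Points of the quotient (V_C / L) / G are orbits, and the quotient map
   sends a point to its orbit. *)
Definition singular_points (R : realType) (gT : finGroupType) (G : {group gT})
    (n : nat) (rG : mx_representation rat G n) (L : zmodClosed 'cV[rat]_n)
    : set (set (torus R L)) :=
  (fun p : torus R L => torus_orbit rG p) @` nontrivial_stab R rG L.

Arguments singular_points R {gT G n} rG L.

Definition moebius (d : nat) : int :=
  if all (fun p => logn p d == 1%N) (primes d) then (-1) ^+ size (primes d)
  else 0.

Definition num_cyclic_subgroups (gT : finGroupType) (G : {group gT}) (d : nat)
    : nat :=
  #|[set H : {group gT} | [&& H \subset G, cyclic H & #|H| == d]]%SET|.

(* Main.v *)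
Require Import Defs.
From HB Require Import structures.
From mathcomp Require Import all_boot all_order all_algebra all_fingroup.
From mathcomp Require Import cyclic cyclotomic mxrepresentation finmap complex.
From mathcomp Require Import boolp classical_sets cardinality reals exp.
From mathcomp Require Import algC.

Set Implicit Arguments.
Unset Strict Implicit.
Unset Printing Implicit Defensive.

Import Order.TTheory GRing.Theory Num.Theory.
Local Open Scope classical_set_scope.
Local Open Scope ring_scope.

(* By rationality and fixed-point-freeness, an element g of order d has
   characteristic polynomial Phi_d^(n / phi(d)). So, for d > 1, it fixes
   |det (g - 1)| = Phi_d(1)^(n / phi(d)) points of the torus, a count given by
   the Smith normal form of g - 1 on the lattice.
   If H is a nontrivial subgroup of G, then sum_(h in H) h maps V into V^H = 0,
   so sum_(h in H) tr h = 0. Since tr g depends only on the order d of g,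
   Moebius inversion over the subgroups of <g> yields tr g = n mu(d) / phi(d).
   Applied to H = G_x the same vanishing shows
   n |F| = sum_x (n - sum_(g in G_x) tr g), and Burnside's formula for G acting
   on F becomes
     n |G| |pi(F)| = sum_(g in G) (n - tr g) |Fix g|
   where x and Fix g are taken in any finite G-stable set containing F. That
   set is the group of N-torsion points, (Z/N)^n, with N a multiple of
   |det (g - 1)| for every g <> 1. Grouping the g by order gives the formula. *)

(** * Moebius function and cyclotomic values at 1 *)

Lemma moebius_primeM (p m : nat) : prime p -> (0 < m)%N ->
  moebius (p * m) = if (p %| m)%N then 0 else - moebius m.
Proof.
move=> pp m0; have p0 := prime_gt0 pp.
case: ifP => [/dvdnP[m' em]|pm].
  rewrite /moebius ifF //; apply/negP => /allP /(_ p).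
  rewrite mem_primes pp muln_gt0 p0 m0 dvdn_mulr // => /(_ isT).
  by rewrite lognM // logn_prime // eqxx eqSS lognE pp m0 em dvdn_mull.
have pr : perm_eq (primes (p * m)) (p :: primes m).
  apply: uniq_perm; rewrite /= ?primes_uniq ?mem_primes ?pp ?m0 ?pm //.
  move=> q; rewrite primesM // in_cons primes_prime //.
  by rewrite inE.
rewrite /moebius (perm_all _ pr) (perm_size pr) /= lognM // logn_prime // eqxx.
rewrite (_ : logn p m = 0%N) ?eqxx /=; last by rewrite lognE pp m0 pm.
rewrite (_ : all _ (primes m) = all (fun q => logn q m == 1%N) (primes m)).
  by case: ifP; rewrite ?oppr0 // exprS mulN1r.
apply/eq_in_all => q; rewrite mem_primes => /and3P[pq _ qm].
rewrite lognM // logn_prime //; case: (q =P p) qm => [->|_ _]; last by rewrite add0n.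
by rewrite pm.
Qed.

(** Fix a prime p dividing d. The divisors of d are the p e with e | d/p, together with the divisors
    e of d/p prime to p. The term of p e cancels that of e when p does not divide e, and vanishes
    otherwise. *)
Lemma sum_moebius (d : nat) : (1 < d)%N ->
  \sum_(e <- divisors d) moebius e = 0.
Proof.
move=> d1; set p := pdiv d; have pp : prime p by exact: pdiv_prime.
have d0 : (0 < d)%N by exact: ltnW.
have /dvdnP[d' ed] : (p %| d)%N by exact: pdiv_dvd.
have d'0 : (0 < d')%N by move: d0; rewrite ed muln_gt0 => /andP[].
have p0 := prime_gt0 pp.
have U := divisors_uniq.
rewrite (bigID (dvdn p)) /= -big_filter.
have E1 : perm_eq [seq e <- divisors d | (p %| e)%N]
    [seq (p * e)%N | e <- divisors d'].
  apply: uniq_perm; rewrite ?filter_uniq ?map_inj_uniq ?U //.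
    by move=> x y /eqP; rewrite eqn_pmul2l // => /eqP.
  move=> e; rewrite mem_filter -dvdn_divisors //; apply/andP/mapP.
    move=> [/dvdnP[e' ->]]; rewrite ed dvdn_pmul2r // => h.
    by exists e'; rewrite -?dvdn_divisors // mulnC.
  move=> [e']; rewrite -dvdn_divisors // => h ->; split; first exact: dvdn_mulr.
  by rewrite ed mulnC dvdn_pmul2r.
have E2 : perm_eq [seq e <- divisors d | ~~ (p %| e)%N]
    [seq e <- divisors d' | ~~ (p %| e)%N].
  apply: uniq_perm; rewrite ?filter_uniq ?U // => e; rewrite !mem_filter.
  case: (boolP (p %| e)%N) => //= pe; rewrite -!dvdn_divisors // ed Gauss_dvdl //.
  by rewrite coprime_sym prime_coprime.
rewrite (perm_big _ E1) -[X in _ + X]big_filter (perm_big _ E2) big_map.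
rewrite big_filter [X in _ + X]big_mkcond -big_split big_seq big1 // => e.
rewrite -dvdn_divisors // => /(dvdn_gt0 d'0) e0; rewrite moebius_primeM //.
by case: (p %| e)%N; rewrite /= ?addr0 // addNr.
Qed.

Lemma Cyclotomic1 : 'Phi_1 = 'X - 1.
Proof. by have := @prod_Cyclotomic 1 isT; rewrite big_seq1. Qed.

(** Dividing X^d - 1 by X - 1 and evaluating at 1 writes d as the product of Phi_e(1) over the
    divisors e > 1 of d. By induction every factor other than Phi_d(1) is positive, hence so is
    Phi_d(1). *)
Lemma Cyclotomic_at1_gt0 (d : nat) : (1 < d)%N -> 0 < ('Phi_d).[1].
Proof.
elim/ltn_ind: d => d IH d1; have d0 : (0 < d)%N := ltnW d1.
have := prod_Cyclotomic d0; rewrite subrX1.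
have d1d : 1%N \in divisors d by rewrite -dvdn_divisors.
have dd : d \in divisors d by rewrite -dvdn_divisors.
rewrite (bigD1_seq 1%N) ?divisors_uniq //= Cyclotomic1.
move/(mulfI (negbT (polyXsubC_eq0 1)))/(congr1 (horner^~ 1)).
rewrite horner_prod -big_filter (bigD1_seq d) ?filter_uniq ?divisors_uniq //=;
  last by rewrite mem_filter dd neq_ltn d1 orbT.
rewrite horner_sum; under [X in _ = X]eq_bigr do rewrite hornerXn expr1n.
rewrite sumr_const card_ord => E.
have : 0 < (d%:R : int) by rewrite ltr0n.
rewrite -E pmulr_lgt0 // big_seq_cond prodr_gt0 // => e.
rewrite mem_filter -dvdn_divisors // => /andP[/andP[e1 ed] nd].
have e0 := dvdn_gt0 d0 ed.
apply: IH; first by rewrite ltn_neqAle nd dvdn_leq.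
by rewrite ltn_neqAle eq_sym e1.
Qed.

(** * Counting group elements by order *)

(** An element of order d generates exactly one cyclic subgroup, and a cyclic group of order d has
    phi(d) generators. *)
Lemma card_order_cyclic (gT : finGroupType) (G : {group gT}) (d : nat) :
  #|[set g in G | #[g]%g == d]%SET| = (totient d * num_cyclic_subgroups G d)%N.
Proof.
rewrite -sum1_card.
rewrite (partition_big (fun g => <[g]>%G)
  [in [set H : {group gT} | [&& H \subset G, cyclic H & #|H| == d]]%SET]) /=.
  rewrite mulnC /num_cyclic_subgroups -sum_nat_const; apply: eq_bigr => H.
  rewrite inE => /and3P[HG /cyclicP[a Ha] /eqP Hd].
  have -> : totient d = #|[set x | generator <[a]>%g x]%SET|.
    by rewrite -totient_gen orderE -Ha Hd.
  rewrite sum1_card; apply: eq_card => x; rewrite !inE /generator -Ha.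
  rewrite unfold_in /= !inE /=.
  apply/andP/eqP => [[_ /eqP <-]//|Hx]; split; last by apply/eqP/val_inj.
  by rewrite -cycle_subG -Hx HG /= orderE -Hx Hd.
by move=> g; rewrite !inE cycle_subG cycle_cyclic -orderE.
Qed.

Lemma sum_by_order (gT : finGroupType) (H : {group gT}) (V : nmodType) (F : gT -> V) :
  \sum_(g in H) F g = \sum_(d <- divisors #|H|) \sum_(g in H | #[g]%g == d) F g.
Proof.
under [RHS]eq_bigr do rewrite big_mkcondr.
rewrite exchange_big /=; apply: eq_bigr => g gH.
rewrite (bigD1_seq #[g]%g) ?divisors_uniq //=; last first.
  by rewrite -dvdn_divisors ?cardG_gt0 // order_dvdG.
by rewrite eqxx big1 ?addr0 // => d; rewrite eq_sym => /negPf ->.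
Qed.

Lemma num_cyclic_subgroups_cyclic (gT : finGroupType) (H : {group gT}) (d : nat) :
  cyclic H -> (d %| #|H|)%N -> num_cyclic_subgroups H d = 1%N.
Proof.
move=> cH dH; have [g defH] := cyclicP cH.
have [K KH cK] : exists2 K : {group gT}, K \subset H & #|K| = d.
  move: dH; rewrite defH -orderE => dH.
  exists <[g ^+ (#[g]%g %/ d)]>%G; first by rewrite cycleX.
  by rewrite -orderE orderXdiv ?dvdn_div // divnA // mulKn.
apply/eqP/cards1P; exists K; apply/setP => K'; rewrite !inE.
apply/and3P/eqP => [[K'H _ /eqP cK']|->]; last by rewrite cK (cyclicS KH).
by apply/val_inj/eqP; rewrite /= (eq_subG_cyclic cH) // cK' cK.
Qed.

(** * Characteristic polynomials, determinants and traces of an FPF representation *)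

(** The minimal polynomial over Q of any root is Phi_d. Dividing it out leaves a monic polynomial
    with the same property, so induction on the size applies. *)
Lemma monic_prim_roots_Cyclotomic (d : nat) (q : {poly rat}) : q \is monic ->
    (forall z : algC, root (map_poly ratr q) z -> d.-primitive_root z) ->
  exists k, q = map_poly intr 'Phi_d ^+ k.
Proof.
have [m] := ubnP (size q); elim: m q => // m IH q szq mq rq.
have [sq1|sq1] := eqVneq (size (map_poly (ratr : rat -> algC) q)) 1%N.
  exists 0%N; move: sq1; rewrite size_map_poly expr0 => sq1.
  have := monicP mq; rewrite lead_coefE sq1 => q0.
  by rewrite [q]size1_polyC ?sq1 // q0.
have /closed_rootP[z rz] := sq1.
have pz := rq _ rz.
have [p [Ep mp] dvdp] := minCpolyP z.
have E : p = map_poly intr 'Phi_d.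
  apply: (map_poly_inj (ratr : {rmorphism rat -> algC})).
  rewrite -Ep (minCpoly_cyclotomic pz) -(Cintr_Cyclotomic pz) -map_poly_comp.
  by apply: eq_map_poly => a /=; rewrite ratr_int.
move: rz; rewrite dvdp => /dvdpP[q' Eq].
have mq' : q' \is monic by move: mq; rewrite Eq monicMr.
have szp : (1 < size p)%N.
  by rewrite E size_rat_int_poly size_Cyclotomic ltnS totient_gt0 (prim_order_gt0 pz).
case: (IH q') => //.
- have sq : size q = (size q' + size p).-1.
    by rewrite Eq size_Mmonic ?monic_neq0.
  rewrite ltnS in szq; apply: leq_trans szq.
  by rewrite sq; case: (size p) szp => [|[|s]] // _; rewrite !addnS ltnS leq_addr.
- by move=> y ry; apply: rq; rewrite Eq rmorphM rootM ry.
- by move=> k Ek; exists k.+1; rewrite Eq Ek E exprSr.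
Qed.

Section FPF.
Variables (gT : finGroupType) (G : {group gT}) (n : nat).
Variable rG : mx_representation rat G n.
Hypothesis fpfG : fpf_repr rG.

(** If z is an eigenvalue of g with eigenvector v, then g^i fixes v as soon as z^i = 1, and this
    forces g^i = 1. So every eigenvalue has the same order as g. *)
Lemma char_poly_fpf (g : gT) : g \in G -> exists2 k,
  n = (k * totient #[g]%g)%N & char_poly (rG g) = map_poly intr 'Phi_#[g]%g ^+ k.
Proof.
move=> gG; have mc := char_poly_monic (rG g).
have [z|k Ek] := @monic_prim_roots_Cyclotomic #[g]%g _ mc.
  rewrite map_char_poly -eigenvalue_root_char => /eigenvalueP[v Av v0].
  have Ae e : v *m map_mx ratr (rG (g ^+ e)%g) = z ^+ e *: v.
    elim: e => [|e IH]; first by rewrite repr_mx1 map_mx1 mulmx1 scale1r.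
    rewrite expgSr repr_mxM ?groupX // map_mxM mulmxA IH -scalemxAl Av scalerA.
    by rewrite exprSr.
  apply/andP; split; first exact: order_gt0.
  (* Primitivity asks, for each [i] below the order d of g, that z be an [i.+1]-th root of unity
     exactly when [i.+1] is d. *)
  apply/forallP => i; apply/eqP; rewrite unity_rootE.
  apply/eqP/eqP => [zi|->]; last first.
    have /eqP := Ae #[g]%g; rewrite expg_order repr_mx1 map_mx1 mulmx1.
    rewrite -{1}[v]scale1r -subr_eq0 -scalerBl scaler_eq0 (negPf v0) orbF.
    by rewrite subr_eq0 => /eqP.
  apply/eqP; rewrite eqn_leq ltn_ord; apply: contraT; rewrite -ltnNge => id.
  have gi1 : (g ^+ i.+1)%g != 1%g.
    rewrite -order_dvdn; apply: contraL id => /(dvdn_leq (ltn0Sn i)).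
    by rewrite -leqNgt.
  have /negP[] := fpfG.2 _ (groupX i.+1 gG) gi1.
  rewrite -(fmorph_eq0 (ratr : {rmorphism rat -> algC})) -det_map_mx.
  apply/det0P; exists v => //.
  by rewrite map_mxB map_mx1 mulmxBr mulmx1 Ae zi scale1r subrr.
exists k => //; have := congr1 (fun p : {poly rat} => (size p).-1) Ek.
by rewrite size_char_poly size_exp size_rat_int_poly size_Cyclotomic mulnC.
Qed.

(** The characteristic polynomial at 1 is det (1 - g). The norm absorbs the sign (-1)^n, and
    Phi_d(1) is already positive for d > 1. *)
Lemma det_fpf (g : gT) : g \in G -> g != 1%g -> exists2 k,
  n = (k * totient #[g]%g)%N & `|\det (rG g - 1%:M)| = ('Phi_#[g]%g).[1]%:~R ^+ k.
Proof.
move=> gG g1; have [k nk Ek] := char_poly_fpf gG; exists k => //.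
have g_gt1 : (1 < #[g]%g)%N by rewrite order_gt1.
have := congr1 (horner_eval 1) Ek; rewrite /char_poly -det_map_mx rmorphXn /=.
rewrite horner_evalE -[1 in RHS](rmorph1 (intr : {rmorphism int -> rat})) horner_map.
move/(congr1 Num.norm); rewrite normrX [X in _ = X ^+ _]ger0_norm; last first.
  by rewrite ler0z ltW ?Cyclotomic_at1_gt0.
have -> : map_mx (horner_eval 1) (char_poly_mx (rG g)) = -1 *: (rG g - 1%:M).
  apply/matrixP => i j; rewrite !mxE /= horner_evalE hornerD hornerN hornerC.
  by rewrite hornerMn hornerX mulN1r opprB.
by rewrite detZ normrM normrX normrN1 expr1n mul1r => <-.
Qed.

Lemma sum_tr_fpf (H : {group gT}) : H \subset G ->
  \sum_(h in H) \tr (rG h) = (H :==: 1%g)%:R * n%:R.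
Proof.
move=> HG; case: eqP => [->|/eqP H1]; first by rewrite big_set1 repr_mx1 mxtrace1 mul1r.
rewrite mul0r -raddf_sum /=.
have [h hH h1] := trivgPn _ H1; have hG := fintype.subsetP HG _ hH.
suff -> : \sum_(h in H) rG h = 0 by rewrite mxtrace0.
(* Left multiplication by h permutes H, so [rG h - 1%:M], which is invertible, annihilates the
   sum. *)
have inv : (rG h - 1%:M) *m \sum_(h in H) rG h = 0.
  rewrite mulmxBl mul1mx mulmx_sumr; apply/eqP; rewrite subr_eq0; apply/eqP.
  rewrite [RHS](reindex_inj (mulgI h)) /=; apply: eq_big => [x|x xH].
    by rewrite groupMl.
  by rewrite repr_mxM // (fintype.subsetP HG).
have u : rG h - 1%:M \in unitmx by rewrite unitmxE unitfE fpfG.2.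
by rewrite -[LHS](mulKmx u) inv mulmx0.
Qed.

(** Both characteristic polynomials are the same power of the same cyclotomic polynomial, and the
    trace is minus the coefficient of degree n - 1. *)
Lemma tr_same_order (g h : gT) : g \in G -> h \in G -> #[g]%g = #[h]%g ->
  \tr (rG g) = \tr (rG h).
Proof.
move=> gG hG gh; have n0 := fpfG.1.
have [k nk Ek] := char_poly_fpf gG; have [l nl El] := char_poly_fpf hG.
have kl : k = l.
  have t0 : (0 < totient #[g]%g)%N by rewrite totient_gt0 order_gt0.
  by apply/eqP; rewrite -(eqn_pmul2r t0) -nk gh -nl.
by apply: oppr_inj; rewrite -!char_poly_trace // Ek El kl gh.
Qed.

(** Induction on the order d of g. As <g> has phi(e) elements of each order e | d, the vanishing of
    its trace sum says that the values phi(e) tr_e, with tr_e the trace in order e, sum to 0 over e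
    | d. The values n mu(e) obey the same recursion and agree at e = 1. *)
Lemma tr_fpf (g : gT) : g \in G ->
  \tr (rG g) * (totient #[g]%g)%:R = n%:R * (moebius #[g]%g)%:~R.
Proof.
have [m] := ubnP #[g]%g; elim: m g => // m IH g; rewrite ltnS => gm gG.
have [->|g1] := eqVneq g 1%g; first by rewrite repr_mx1 mxtrace1 order1 mulr1.
have d1 : (1 < #[g]%g)%N by rewrite order_gt1.
have d0 := ltnW d1.
have gsub : <[g]>%g \subset G by rewrite cycle_subG.
have := sum_tr_fpf gsub; rewrite cycle_eq1 (negPf g1) mul0r.
rewrite sum_by_order -orderE (bigD1_seq #[g]%g) ?divisors_uniq -?dvdn_divisors //=.
have card e : (e %| #[g]%g)%N ->
    #|[pred h | (h \in <[g]>%g) && (#[h]%g == e)]| = totient e.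
  move=> ed; have cg := cycle_cyclic g.
  rewrite -[RHS]muln1 -(@num_cyclic_subgroups_cyclic _ <[g]>%G e) //.
  by rewrite -card_order_cyclic; apply: eq_card => h; rewrite !inE.
rewrite (eq_bigr (fun=> \tr (rG g))); last first.
  by move=> h /andP[/(fintype.subsetP gsub) hG /eqP hg]; apply: tr_same_order.
rewrite sumr_const card // mulr_natr => /eqP; rewrite addr_eq0 => /eqP ->.
have := sum_moebius d1; rewrite (bigD1_seq #[g]%g) ?divisors_uniq -?dvdn_divisors //=.
move/eqP; rewrite addr_eq0 => /eqP ->; rewrite rmorphN mulrN; congr (- _).
rewrite rmorph_sum mulr_sumr [LHS]big_seq_cond [RHS]big_seq_cond; apply: eq_bigr => e.
rewrite -dvdn_divisors // => /andP[ed ng].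
have e0 := dvdn_gt0 d0 ed.
have t0 : (totient e)%:R != 0 :> rat by rewrite pnatr_eq0 -lt0n totient_gt0.
rewrite (eq_bigr (fun=> n%:R * (moebius e)%:~R / (totient e)%:R)); last first.
  move=> h /andP[/(fintype.subsetP gsub) hG /eqP he]; rewrite -he -IH ?he ?mulfK //.
  by apply: leq_trans gm; rewrite ltn_neqAle ng dvdn_leq.
by rewrite sumr_const card // -[LHS]mulr_natr divfK.
Qed.
End FPF.

(** * Kernels of integer matrices modulo N *)

Lemma intr_Zp_eq0 (N : nat) (z : int) : (1 < N)%N ->
  (z%:~R == 0 :> 'Z_N) = (N %| `|z|)%N.
Proof.
move=> N1; have H m : (m%:R == 0 :> 'Z_N) = (N %| m)%N.
  by rewrite -val_eqE /= val_Zp_nat.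
by case: z => m; [exact: H | rewrite NegzE mulrNz oppr_eq0; exact: H].
Qed.

(** The solutions are the multiples of N / |z|, and there are |z| of them modulo N. *)
Lemma card_annihilator_Zp (N : nat) (z : int) : (1 < N)%N -> (`|z| %| N)%N ->
  #|[set a : 'Z_N | z%:~R * a == 0]%SET| = `|z|%N.
Proof.
move=> N1 zN; have N0 := ltnW N1; have z0 := dvdn_gt0 N0 zN.
have E (a : 'Z_N) : (z%:~R * a == 0) = (N %/ `|z| %| a)%N.
  rewrite -[a in LHS]natr_Zp -[_%:R]/((Posz a)%:~R) -intrM intr_Zp_eq0 // abszM /=.
  by rewrite -[X in (X %| _)%N](divnK zN) mulnC dvdn_pmul2l.
have m0 : (0 < N %/ `|z|)%N by rewrite divn_gt0 // dvdn_leq.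
have lt (i : 'I_`|z|) : (N %/ `|z| * i < N)%N.
  by rewrite -[X in (_ < X)%N](divnK zN) ltn_pmul2l.
have valE (i : 'I_`|z|) : ((N %/ `|z| * i)%:R : 'Z_N) = (N %/ `|z| * i)%N :> nat.
  by rewrite val_Zp_nat // modn_small.
rewrite -[RHS]card_ord.
rewrite -(card_imset _ (f := fun i : 'I_`|z| => (N %/ `|z| * i)%:R : 'Z_N)); last first.
  move=> i j ij; have := congr1 (@nat_of_ord _) ij; rewrite !valE => /eqP.
  by rewrite eqn_pmul2l // => /eqP/val_inj.
apply: eq_card => a; rewrite inE E; apply/idP/imsetP => [/dvdnP[q aq]|[i _ ->]].
  have qz : (q < `|z|)%N.
    rewrite -(ltn_pmul2r m0) -aq [X in (_ < X)%N]mulnC divnK //.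
    by have := ltn_ord a; rewrite [X in (_ < X)%N]Zp_cast.
  by exists (Ordinal qz) => //; apply: val_inj; rewrite [RHS]valE /= mulnC.
by rewrite valE dvdn_mulr.
Qed.

Lemma card_cV_pred (T : finType) (n : nat) (P : 'I_n -> pred T) :
  #|[set x : 'cV[T]_n | [forall i, P i (x i 0)]]%SET| = (\prod_i #|P i|)%N.
Proof.
have inj : injective (fun f : {ffun 'I_n -> T} => \col_i f i).
  by move=> f g /colP fg; apply/ffunP => i; have := fg i; rewrite !mxE.
have -> : (\prod_i #|P i|)%N = #|family P|.
  by rewrite card_family foldrE big_image.
rewrite -(card_imset _ inj); apply: eq_card => x; rewrite inE.
apply/forallP/imsetP => [Px|[f /familyP Pf ->] i]; last by rewrite mxE; apply: Pf.
exists [ffun i => x i 0]; first by apply/familyP => i; rewrite ffunE; apply: Px.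
by apply/colP => i; rewrite mxE ffunE.
Qed.

(** In the Smith form M = U D W, the factors U and W stay invertible modulo N, so y |-> W^-1 y maps
    ker D bijectively onto ker M. The kernel of D splits into coordinates; each d_i divides det D,
    hence N, and contributes |d_i| solutions. *)
Lemma card_ker_Zp (n N : nat) (M : 'M[int]_n) : (1 < N)%N -> (`|\det M| %| N)%N ->
  #|[set x : 'cV['Z_N]_n | map_mx intr M *m x == 0]%SET| = `|\det M|%N.
Proof.
move=> N1; have [U uU [W uW [d _ ->]]] := int_Smith_normal_form M.
set D := \matrix_(i, j) _.
have unitN A : A \in unitmx -> map_mx intr A \in @unitmx 'Z_N n.
  by rewrite !unitmxE det_map_mx => uA; apply: rmorph_unit.
have abs1 A : A \in unitmx -> `|\det A : int|%N = 1%N.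
  by rewrite unitmxE => /orP[] /eqP ->.
have detD : \det D = \prod_(i < n) d`_i.
  rewrite (_ : D = diag_mx (\row_i d`_i)) ?det_diag.
    by apply: eq_bigr => i _; rewrite mxE.
  by apply/matrixP => i j; rewrite !mxE.
rewrite !det_mulmx !abszM (abs1 _ _ uU) (abs1 _ _ uW) mul1n muln1 => DN.
rewrite !map_mxM; set U' := map_mx _ U; set W' := map_mx _ W; set D' := map_mx _ D.
have -> : #|[set x : 'cV['Z_N]_n | U' *m D' *m W' *m x == 0]%SET| =
          #|[set x : 'cV['Z_N]_n | D' *m x == 0]%SET|.
  rewrite -[RHS](card_imset _ (can_inj (mulKVmx (unitN _ uW)))).
  apply: eq_card => x; rewrite inE; apply/eqP/imsetP => [h|[y]].
    exists (W' *m x); last by rewrite mulKmx ?unitN.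
    rewrite inE -[D' *m _](mulKmx (unitN _ uU)) !mulmxA.
    by rewrite -3!(mulmxA (invmx _)) h mulmx0.
  by rewrite inE => /eqP h ->; rewrite -mulmxA mulKVmx ?unitN // -mulmxA h mulmx0.
have abs_detD : `|\det D|%N = (\prod_(i < n) `|(d`_i)%R|)%N.
  by rewrite detD (big_morph _ abszM (erefl : `|1 : int|%N = 1%N)).
pose P (i : 'I_n) := [pred a : 'Z_N | (d`_i)%:~R * a == 0].
rewrite abs_detD; transitivity (\prod_i #|P i|)%N; last first.
  apply: eq_bigr => i _; rewrite -(card_annihilator_Zp N1); last first.
    by apply: dvdn_trans DN; rewrite abs_detD (bigD1 i) //= dvdn_mulr.
  by apply: eq_card => a; rewrite inE.
rewrite -card_cV_pred; apply: eq_card => x; rewrite !inE.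
have D'x i : (D' *m x) i 0 = (d`_i)%:~R * x i 0.
  rewrite !mxE (bigD1 i) //= big1 ?addr0 => [|j ji]; rewrite !mxE ?eqxx //.
  by rewrite val_eqE [i == j]eq_sym (negPf ji) mul0r.
apply/eqP/forallP => [h i|h]; first by rewrite /= -D'x h mxE.
by apply/colP => i; rewrite D'x mxE; apply/eqP/h.
Qed.

(** * Counting orbits of points with nontrivial stabilizer *)

Section Orbits.
Variables (gT : finGroupType) (G : {group gT}) (n : nat).
Variable rG : mx_representation rat G n.
Hypothesis fpfG : fpf_repr rG.
Variables (X : finType) (to : action G X).

Let F := [set x : X | 'C[x | to]%g != 1%g]%SET.

Lemma in_astab1 (g : gT) (x : X) : (g \in 'C[x | to]%g) = (g \in G) && (to x g == x).
Proof. by rewrite !inE finset.sub1set inE. Qed.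

(** Stabilizers along an orbit are conjugate. *)
Lemma acts_nontrivial_astab : [acts G, on F | to]%g.
Proof.
apply/fintype.subsetP => g gG; rewrite !inE gG /=; apply/fintype.subsetP => x.
rewrite !inE astab1_act_in //; apply: contra => /eqP h.
by apply/eqP/(@conjsg_inj _ g); rewrite h conjs1g.
Qed.

Lemma card_nontrivial_orbits :
  n%:R * (#|[set orbit to G x | x in F]%SET| * #|G|)%:R =
  \sum_(g in G) (n%:R - \tr (rG g)) * #|'Fix_to[g]%g|%:R :> rat.
Proof.
rewrite -(Frobenius_Cauchy acts_nontrivial_astab) natr_sum.
have afixE g x : g \in G -> (x \in 'Fix_to[g]%g) = (g \in 'C[x | to]%g).
  move=> gG; rewrite in_astab1 gG; apply/idP/eqP => [/afixP/(_ g)|h].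
    by apply; rewrite inE.
  by apply/afixP => h'; rewrite inE => /eqP ->.
have fixF g : g \in G -> g != 1%g -> 'Fix_(F | to)[g]%g = 'Fix_to[g]%g.
  move=> gG g1; apply/finset.setIidPr/fintype.subsetP => x; rewrite afixE // => xg.
  by rewrite inE; apply/trivgPn; exists g.
have F1 : 'Fix_(F | to)[1]%g = F.
  by apply/finset.setIidPl/fintype.subsetP => x _; rewrite afixE ?group1.
have X1 : #|'Fix_to[1]%g| = #|X|.
  by apply: eq_card => x; rewrite afixE ?group1 // inE.
(* Exchanging summations turns the sum of tr g |Fix g| into a sum over x of the traces on the
   stabilizer of x: this is n off F and 0 on F. *)
have nF : n%:R * #|F|%:R =
    n%:R * #|X|%:R - \sum_(g in G) \tr (rG g) * #|'Fix_to[g]%g|%:R.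
  have -> : \sum_(g in G) \tr (rG g) * #|'Fix_to[g]%g|%:R =
            \sum_x ('C[x | to]%g == 1%g)%:R * n%:R.
    under eq_bigr => g gG do rewrite -sum1_card natr_sum mulr_sumr.
    under eq_bigr => g gG do (under eq_bigl => x do rewrite afixE //).
    rewrite (exchange_big_dep predT) //=; apply: eq_bigr => x _.
    have CG : 'C[x | to]%g \subset G by exact: subsetIl.
    rewrite -(sum_tr_fpf fpfG CG); apply: eq_big => [g|g _]; last by rewrite mulr1.
    by rewrite in_astab1 andbA andbb.
  rewrite -mulr_suml -natr_sum [X in _ - X]mulrC -mulrBr; congr (_ * _).
  rewrite -(cardsC F) natrD -[LHS]addr0 -addrA; congr (_ + _).
  have -> : (\sum_x ('C[x | to]%g == 1%g) = #|~: F|)%N; last by rewrite subrr.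
  have -> : ~: F = [set x | 'C[x | to]%g == 1%g]%SET.
    by apply/setP => x; rewrite !finset.in_setC !finset.in_set negbK.
  by rewrite -sum1dep_card [RHS]big_mkcond; apply: eq_bigr => x _; case: eqP.
(* On the right the term of g = 1 vanishes, since n = tr 1. On the left it is n |F|, where n |X|
   cancels against the term of g = 1 in the trace sum. *)
rewrite (bigD1 (1%g : gT)) //= [RHS](bigD1 (1%g : gT)) //= F1 repr_mx1 mxtrace1.
rewrite subrr mul0r add0r.
rewrite mulrDr nF [in X in _ - X](bigD1 (1%g : gT)) //= repr_mx1 mxtrace1 X1.
rewrite opprD addrA subrr add0r mulr_sumr addrC -sumrB.
apply: eq_bigr => g /andP[gG g1].
by rewrite mulrBl fixF.
Qed.

Lemma card_nontrivial_orbits_Cyclotomic (R : realType) :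
    (forall g, g \in G -> g != 1%g ->
      #|'Fix_to[g]%g|%:R = `|\det (rG g - 1%:M)|) ->
  #|[set orbit to G x | x in F]%SET|%:R =
    #|G|%:R^-1 *
    \sum_(d <- divisors #|G|)
      ((totient d)%:R - (moebius d)%:~R) * (num_cyclic_subgroups G d)%:R *
      ('Phi_d).[1]%:~R `^ (n%:R / (totient d)%:R) :> R.
Proof.
move=> fixE; have n0 : n%:R != 0 :> R by rewrite pnatr_eq0 -lt0n fpfG.1.
have G0 : #|G|%:R != 0 :> R by rewrite pnatr_eq0 -lt0n cardG_gt0.
(* Multiplying by phi(d) avoids division in the trace formula. At g = 1 both sides vanish, because n
   = tr 1 and phi(1) = mu(1). *)
have term g : g \in G ->
    ratr ((n%:R - \tr (rG g)) * #|'Fix_to[g]%g|%:R) * (totient #[g]%g)%:R =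
    n%:R * (((totient #[g]%g)%:R - (moebius #[g]%g)%:~R) *
      ('Phi_#[g]%g).[1]%:~R `^ (n%:R / (totient #[g]%g)%:R)) :> R.
  move=> gG; have [->|g1] := eqVneq g 1%g.
    by rewrite repr_mx1 mxtrace1 subrr mul0r rmorph0 order1 subrr !mul0r mulr0.
  have [k nk dk] := det_fpf fpfG gG g1; rewrite fixE // dk.
  have t0 : (totient #[g]%g)%:R != 0 :> R.
    by rewrite pnatr_eq0 -lt0n totient_gt0 order_gt0.
  (* The exponent n / phi(d) is the integer k, so the real power becomes an ordinary one. *)
  have -> : n%:R / (totient #[g]%g)%:R = k%:R :> R by rewrite nk natrM mulfK.
  rewrite powR_mulrn; last first.
    by rewrite ler0z ltW // Cyclotomic_at1_gt0 // order_gt1.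
  have key : ratr (n%:R - \tr (rG g)) * (totient #[g]%g)%:R =
      n%:R * ((totient #[g]%g)%:R - (moebius #[g]%g)%:~R) :> R.
    rewrite -[X in _ * X = _]ratr_nat -rmorphM /= mulrBl tr_fpf // -mulrBr.
    by rewrite rmorphM rmorphB /= !ratr_nat ratr_int.
  by rewrite rmorphM rmorphXn /= ratr_int mulrAC key mulrA.
have /(congr1 (ratr : rat -> R)) := card_nontrivial_orbits.
rewrite sum_by_order natrM !rmorphM /= !ratr_nat rmorph_sum /= => E.
apply: (mulfI n0); apply: (mulIf G0); rewrite -mulrA E.
rewrite [X in _ = X * _]mulrCA [RHS]mulrAC mulVf // mul1r mulr_sumr.
rewrite big_seq [RHS]big_seq /=; apply: eq_bigr => d.
rewrite -dvdn_divisors ?cardG_gt0 // => dG; rewrite rmorph_sum /=.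
have t0 : (totient d)%:R != 0 :> R.
  by rewrite pnatr_eq0 -lt0n totient_gt0 (dvdn_gt0 _ dG).
set f := _ `^ _.
rewrite (eq_bigr (fun=> n%:R * (((totient d)%:R - (moebius d)%:~R) * f) /
                         (totient d)%:R)).
  rewrite sumr_const.
  have -> : #|[pred g | (g \in G) && (#[g]%g == d)]| =
      (totient d * num_cyclic_subgroups G d)%N.
    by rewrite -card_order_cyclic; apply: eq_card => g; rewrite !inE.
  rewrite -[LHS]mulr_natr natrM mulrA divfK // -!mulrA.
  by congr (_ * (_ * _)); exact: mulrC.
by move=> g /andP[gG /eqP gd]; apply: (mulIf t0); rewrite divfK // -gd term // gd.
Qed.

End Orbits.

(** * Integral coordinates on the lattice *)

Lemma lattice_basis_mx (n : nat) (L : zmodClosed 'cV[rat]_n) : full_rank_lattice L ->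
  exists2 B : 'M[rat]_n, B \in unitmx &
    forall v, v \in L <-> exists w : 'cV[int]_n, v = B *m map_mx intr w.
Proof.
case; have -> : \dim {:'cV[rat]_n} = n by rewrite dimvf dim_matrix mulr1.
(* The columns of [B] are the given Z-basis of L. *)
move=> b bas latP; pose B : 'M_n := \matrix_(i, j) b`_j i 0.
have Bmul w : B *m w = \sum_j w j 0 *: b`_j.
  apply/colP => i; rewrite mxE summxE; apply: eq_bigr => j _.
  by rewrite !mxE mulrC.
exists B.
  rewrite unitmxE unitfE -det_tr; apply/negP => /det0P[v v0 vB].
  have /freeP fr := basis_free bas.
  have h := fr (fun j => v 0 j).
  case/eqP: v0; apply/rowP => j; rewrite mxE h //.
  have := congr1 trmx vB; rewrite trmx_mul trmxK trmx0 Bmul => sv0.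
  by rewrite -[RHS]sv0; apply: eq_bigr => k _; rewrite mxE.
move=> v; rewrite latP; split=> [[a ->]|[w ->]].
  exists (\col_i a i); rewrite Bmul; apply: eq_bigr => j _.
  by rewrite !mxE scaler_int.
exists [ffun i => w i 0]; rewrite Bmul; apply: eq_bigr => j _.
by rewrite !mxE ffunE scaler_int.
Qed.

(** Column j of B^-1 g B holds the coordinates of g b_j, a vector of L by stability, so its entries
    are integers and [numq] recovers them. *)
Lemma repr_integral_mx (gT : finGroupType) (G : {group gT}) (n : nat)
    (rG : mx_representation rat G n) (L : zmodClosed 'cV[rat]_n) (B : 'M[rat]_n) :
    B \in unitmx ->
    (forall v, v \in L <-> exists w : 'cV[int]_n, v = B *m map_mx intr w) ->
    repr_stable rG L ->
  exists A : gT -> 'M[int]_n, forall g, g \in G -> rG g *m B = B *m map_mx intr (A g).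
Proof.
move=> uB LB stab; exists (fun g => map_mx numq (invmx B *m rG g *m B)) => g gG.
suff -> : map_mx intr (map_mx numq (invmx B *m rG g *m B)) = invmx B *m rG g *m B.
  by rewrite !mulmxA mulmxV // mul1mx.
apply/matrixP => i j; set P := _ *m _ *m _.
have [z Pz] : exists z : int, P i j = z%:~R.
  have : rG g *m (B *m map_mx intr (delta_mx j 0 : 'cV_n)) \in L.
    by apply: stab => //; apply/LB; exists (delta_mx j 0).
  move/LB => [w]; rewrite map_delta_mx => /(congr1 (mulmx (invmx B))).
  rewrite mulKmx // !mulmxA -colE => /colP/(_ i); rewrite [LHS]mxE [RHS]mxE => Pw.
  by exists (w i 0).
by rewrite [LHS]mxE [X in intr X]mxE Pz numq_int.
Qed.

Lemma map_mx_Zp_eq0 (N n : nat) (v : 'cV[int]_n) : (1 < N)%N ->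
  map_mx intr v = 0 :> 'cV['Z_N]_n <-> exists w : 'cV[int]_n, v = N%:Z *: w.
Proof.
move=> N1; split=> [v0|[w ->]].
  exists (map_mx (fun a => a %/ N%:Z)%Z v); apply/colP => i; rewrite !mxE.
  have /colP/(_ i)/eqP := v0; rewrite !mxE intr_Zp_eq0 // => Nv.
  by rewrite mulrC divzK // dvdzE.
apply/colP => i; rewrite !mxE; apply/eqP; rewrite intr_Zp_eq0 // abszM.
exact: dvdn_mulr.
Qed.

(** * Torsion points of the torus *)

Section Torsion.
Variables (R : realType) (gT : finGroupType) (G : {group gT}) (n : nat).
Variables (rG : mx_representation rat G n) (L : zmodClosed 'cV[rat]_n).
Hypothesis fpfG : fpf_repr rG.
Hypothesis invL : repr_stable rG L.
Variable B : 'M[rat]_n.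
Hypothesis uB : B \in unitmx.
Hypothesis LB : forall v, v \in L <-> exists w : 'cV[int]_n, v = B *m map_mx intr w.
Variable A : gT -> 'M[int]_n.
Hypothesis AB : forall g, g \in G -> rG g *m B = B *m map_mx intr (A g).
Variable N : nat.
Hypothesis N1 : (1 < N)%N.

Let intr_mx_inj m1 m2 : injective (map_mx intr : 'M[int]_(m1, m2) -> 'M[rat]_(m1, m2)).
Proof.
move=> M M' /matrixP h; apply/matrixP => i j.
by have := h i j; rewrite !mxE => /intr_inj.
Qed.

Let NQ : N%:R != 0 :> rat. Proof. by rewrite pnatr_eq0 -lt0n ltnW. Qed.

Lemma integral_mx1 : A 1%g = 1%:M.
Proof.
apply: intr_mx_inj; apply: (can_inj (mulKmx uB)).
by rewrite -AB // repr_mx1 map_mx1 mulmx1 mul1mx.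
Qed.

Lemma integral_mxM : {in G &, forall g h, A (g * h)%g = A g *m A h}.
Proof.
move=> g h gG hG; apply: intr_mx_inj; apply: (can_inj (mulKmx uB)).
by rewrite -AB ?groupM // repr_mxM // map_mxM mulmxA -AB // -!mulmxA -AB.
Qed.

Lemma det_integral_mx g : g \in G ->
  \det (rG g - 1%:M) = (\det (A g - 1%:M))%:~R.
Proof.
move=> gG; rewrite -det_map_mx map_mxB map_mx1.
have -> : rG g - 1%:M = B *m (map_mx intr (A g) - 1%:M) *m invmx B.
  by rewrite mulmxBr -AB // mulmx1 mulmxBl mulmxK // mulmxV.
by rewrite !det_mulmx det_inv mulrAC mulfV ?mul1r // -unitfE -unitmxE.
Qed.

(** The class of (1/N) B v; as v varies, these are all the N-torsion points. *)
Definition torsion_point (v : 'cV[int]_n) : torus R L :=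
  torus_proj L (map_mx ratr (B *m (N%:R^-1 *: map_mx intr v))).

Lemma torsion_point_eq v w : torsion_point v = torsion_point w <->
  map_mx intr v = map_mx intr w :> 'cV['Z_N]_n.
Proof.
rewrite torus_projP -map_mxB -mulmxBr -scalerBr -map_mxB.
transitivity (map_mx intr (v - w) = 0 :> 'cV['Z_N]_n); last first.
  by rewrite map_mxB; split => [/subr0_eq->//|->]; rewrite subrr.
rewrite map_mx_Zp_eq0 //; split=> [/asboolP[u uL] /map_mx_inj E|[x E]].
  have /LB[x ux] := uL; exists x; apply: intr_mx_inj.
  move: E; rewrite ux => /(can_inj (mulKmx uB)) /(congr1 ( *:%R N%:R)).
  by rewrite scalerA mulfV // scale1r map_mxZ.
apply/asboolP; exists (B *m map_mx intr x); first by apply/LB; exists x.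
by rewrite E map_mxZ scalerA mulVf // scale1r.
Qed.

Lemma torus_act_torsion_point g v : g \in G ->
  torus_act rG g (torsion_point v) = torsion_point (A g *m v).
Proof.
move=> gG; rewrite torus_act_proj // -map_mxM mulmxA AB //.
by rewrite -mulmxA -scalemxAr -map_mxM.
Qed.

(** Identifies (Z/N)^n with the N-torsion subgroup, through representatives in [0, N). *)
Definition torsion_embed (x : 'cV['Z_N]_n) : torus R L :=
  torsion_point (map_mx (fun a : 'Z_N => (a : nat)%:Z) x).

Let lift_red (x : 'cV['Z_N]_n) :
  map_mx intr (map_mx (fun a : 'Z_N => (a : nat)%:Z) x) = x.
Proof. by apply/colP => i; rewrite !mxE -[RHS]natr_Zp. Qed.

Lemma torsion_embed_red v : torsion_embed (map_mx intr v) = torsion_point v.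
Proof. by apply/torsion_point_eq; rewrite lift_red. Qed.

Lemma torsion_embed_inj : injective torsion_embed.
Proof. by move=> x y /torsion_point_eq; rewrite !lift_red. Qed.

Lemma torus_act_embed g x : g \in G ->
  torus_act rG g (torsion_embed x) = torsion_embed (map_mx intr (A g) *m x).
Proof.
move=> gG; rewrite torus_act_torsion_point // -torsion_embed_red map_mxM.
by rewrite lift_red.
Qed.

(** A class [x] is fixed by g when (g - 1) x = B w for an integer vector w, that is x = B D^-1 w
    with D = A g - 1. Since det D divides N, the matrix N D^-1 is integral, so [x] is an N-torsion
    point. *)
Lemma torus_fixed_torsion g (p : torus R L) : g \in G -> g != 1%g ->
    (`|\det (A g - 1%:M)| %| N)%N -> torus_act rG g p = p ->
  exists x, p = torsion_embed x.
Proof.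
move=> gG g1 dN; set D := A g - 1%:M in dN.
have Ep : torus_proj L (generic_quotient.repr p) = p by exact: generic_quotient.reprK.
rewrite -Ep torus_act_proj //; set x := generic_quotient.repr p.
move=> /torus_projP/asboolP[u /LB[w ->] E].
have detD : \det D != 0.
  by rewrite -(intr_eq0 rat) -det_integral_mx // fpfG.2.
have [q Nq] : exists q : int, N%:Z = q * \det D.
  by apply/dvdzP; rewrite dvdzE.
(* This is N D^-1 w, written with the adjugate to stay over the integers. *)
pose v := q *: (\adj D *m w).
have Dv : D *m v = N%:Z *: w.
  by rewrite -scalemxAr mulmxA mul_mx_adj mul_scalar_mx scalerA -Nq.
exists (map_mx intr v); rewrite torsion_embed_red; congr torus_proj.
set y := B *m _.
have uC : map_mx ratr (rG g - 1%:M) \in @unitmx R[i] n.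
  by rewrite map_unitmx unitmxE unitfE fpfG.2.
(* As g - 1 is invertible over C, it suffices to compare x and y after applying it. *)
apply: (can_inj (mulKmx uC)); rewrite -map_mxM.
have -> : (rG g - 1%:M) *m y = B *m map_mx intr w.
  rewrite mulmxBl mul1mx mulmxA AB // -mulmxA -mulmxBr; congr (_ *m _).
  rewrite -[X in _ - X]mul1mx -mulmxBl -(map_mx1 intr) -map_mxB -scalemxAr -map_mxM.
  by rewrite Dv map_mxZ scalerA mulVf // scale1r.
by rewrite -E map_mxB map_mx1 mulmxBl mul1mx.
Qed.

End Torsion.

(** * Transfer of the orbit count from the torsion points to the torus *)

Theorem theorem3p6 (R : realType) (gT : finGroupType) (G : {group gT})
    (n : nat) (rG : mx_representation rat G n) (L : zmodClosed 'cV[rat]_n)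
    (fpfG : fpf_repr rG) (latL : full_rank_lattice L)
    (invL : repr_stable rG L) :
  finite_set (singular_points R rG L) /\
  (#|` fset_set (singular_points R rG L)|)%fset%:R =
    #|G|%:R^-1 *
    \sum_(d <- divisors #|G|)
      ((totient d)%:R - (moebius d)%:~R) * (num_cyclic_subgroups G d)%:R *
      ('Phi_d).[1]%:~R `^ (n%:R / (totient d)%:R) :> R.
Proof.
have [B uB LB] := lattice_basis_mx latL.
have [A AB] := repr_integral_mx uB LB invL.
have A1 := integral_mx1 uB AB; have AM := integral_mxM uB AB.
have detA := det_integral_mx uB AB.
(* A nonzero common multiple of all |det (g - 1)|, g <> 1: it makes every such fixed point N-torsion
   and the kernel count modulo N exact. *)
pose m := (\prod_(g in G | g != 1%g) `|(\det (A g - 1%:M))%R|)%N.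
(* The factor 2 ensures 1 < N: ['Z_1] is Z/2. *)
pose N := (2 * m)%N.
have m0 : (0 < m)%N.
  rewrite prodn_cond_gt0 // => g /andP[gG g1].
  by rewrite absz_gt0 -(intr_eq0 rat) -detA // fpfG.2.
have N1 : (1 < N)%N by exact: leq_pmulr.
have dN g : g \in G -> g != 1%g -> (`|\det (A g - 1%:M)| %| N)%N.
  by move=> gG g1; rewrite dvdn_mull // /m (bigD1 g) ?gG //= dvdn_mulr.
pose Am g : 'M['Z_N]_n := map_mx intr (A g).
have AmM : {in G &, forall g h, Am (g * h)%g = Am g *m Am h}.
  by move=> g h gG hG; rewrite /Am AM // map_mxM.
have Am1 : Am 1%g = 1%:M by rewrite /Am A1 map_mx1.
(* [act] composes on the right, whence the inverse. *)
pose to (x : 'cV['Z_N]_n) g := if g \in G then Am g^-1%g *m x else x.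
have toP : is_action G to.
  split=> [g x y|x g h gG hG]; rewrite /to.
    case: ifP => // gG /(congr1 (mulmx (Am g))).
    by rewrite !mulmxA -AmM ?groupV // mulgV Am1 !mul1mx.
  by rewrite groupM // gG hG mulmxA -AmM ?groupV // invMg.
pose act := Action toP.
have actE x g : g \in G -> act x g = Am g^-1%g *m x by move=> gG; rewrite /= /to gG.
have act_fix x g : g \in G -> (act x g == x) = (Am g *m x == x).
  move=> gG; rewrite actE //; apply/eqP/eqP => {1}<-.
    by rewrite mulmxA -AmM ?groupV // mulgV Am1 mul1mx.
  by rewrite mulmxA -AmM ?groupV // mulVg Am1 mul1mx.
(* The vectors fixed by g modulo N form the kernel of A g - 1. *)
have fixE g : g \in G -> g != 1%g -> #|'Fix_act[g]%g|%:R = `|\det (rG g - 1%:M)|.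
  move=> gG g1; rewrite detA // -intr_norm -abszE -(card_ker_Zp N1 (dN g gG g1)).
  congr (_%:R); apply: eq_card => x; rewrite [RHS]inE map_mxB map_mx1 mulmxBl mul1mx.
  by rewrite subr_eq0 -act_fix //; apply/afix1P/eqP.
have orbE := card_nontrivial_orbits_Cyclotomic fpfG R fixE.
set F := [set x | _]%SET in orbE.
pose e : 'cV['Z_N]_n -> torus R L := @torsion_embed R n L B N.
have e_inj : injective e by apply: (torsion_embed_inj uB LB N1).
have eA g x : g \in G -> torus_act rG g (e x) = e (Am g *m x).
  exact: (torus_act_embed R invL uB LB AB N1).
have stabE x : torus_stab rG (e x) = 'C[x | act]%g.
  apply/setP => g; rewrite in_astab1 finset.in_set.
  by case: (boolP (g \in G)) => //= gG; rewrite eA // (inj_eq e_inj) act_fix.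
(* All torus points with nontrivial stabilizer are N-torsion, and [e] preserves stabilizers, so they
   correspond to the finite set [F]. *)
have nsE : nontrivial_stab R rG L = e @` [set` F].
  apply/seteqP; split=> [p pN|_ [x /= xF <-]]; last first.
    by rewrite /nontrivial_stab /= stabE; apply/eqP; move: xF; rewrite inE.
  have [g /andP[]|no_g] :=
    pickP [pred g | (g \in torus_stab rG p) && (g != 1%g)]; last first.
    case: pN; apply/setP => g; rewrite finset.in_set1; have /= := no_g g.
    case: eqVneq => [->|_]; rewrite ?andbF ?andbT // => _.
    rewrite finset.in_set group1 -[p](@generic_quotient.reprK) torus_act_proj //.
    by rewrite repr_mx1 map_mx1 mul1mx; apply: eqxx.
  rewrite finset.in_set => /andP[gG /eqP gp] g1.
  have [x px] := torus_fixed_torsion fpfG invL uB LB AB N1 gG g1 (dN g gG g1) gp.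
  by exists x => //=; rewrite inE -stabE; apply/eqP; rewrite /e -px.
(* Inverses pass between the left action on the torus and the right action [act]; orbits are the
   same for both. *)
have torE x : torus_orbit rG (e x) = e @` [set` orbit act G x].
  apply/seteqP; split=> [_ [g /= gG <-]|_ [y /= /orbitP[g gG <-] <-]].
    exists (act x g^-1%g); first by apply: mem_orbit; rewrite groupV.
    by rewrite actE ?groupV // invgK eA.
  exists g^-1%g; first by rewrite /= groupV.
  by rewrite eA ?groupV // actE.
pose O := [set orbit act G x | x in F]%SET.
(* Singular points are orbits, hence sets of torus points; the injective map [h] on subsets carries
   the finite orbits in [O] onto them. *)
pose h (S : {set 'cV['Z_N]_n}) : set (torus R L) := e @` [set` S].
have h_mem S x : h S (e x) <-> x \in S.
  by split=> [[y /= yS /e_inj <-]//|xS]; exists x.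
have h_inj : injective h.
  move=> S T ST; apply/setP => x.
  by apply/idP/idP => /h_mem; [rewrite ST | rewrite -ST] => /h_mem.
have spE : singular_points R rG L = h @` [set` O].
  rewrite /singular_points nsE; apply/seteqP; split.
    move=> _ [_ [x /= xF <-] <-]; exists (orbit act G x); rewrite ?torE //=.
    exact: imset_f.
  move=> _ [_ /= /imsetP[x xF ->] <-]; exists (e x); last exact: torE.
  by exists x.
rewrite spE; split; first exact/finite_image/finite_finset.
rewrite -orbE; congr (_%:R); rewrite -/O.
apply: card_fset_set.
apply: (card_eq_trans (inj_card_eq _)).
  by move=> S T _ _; apply: h_inj.
have -> : [set` O] = [set` [fset S in O]%fset].
  by apply/seteqP; split=> S /=; rewrite !inE.
by apply/card_eq_fsetP; rewrite card_finset.
Qed.
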